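(* Let $G$ be a graph, let $f$ be a positive integer-valued function on $V(G)$, and let $a$ be a real number with $1\le a\le f(v)$ for all $v\in V(G)$. Suppose $G$ is $t$-iso-tough where $t(v)=\frac{1}{a}\big(f(v)+\frac{a}{2}\big)^2$, and for all $S\subseteq V(G)$ $$\omega(G\setminus S)<\sum_{v\in S}\big(f(v)-a\big)+2.$$ Then $G$ has a near $f$-factor.
   Context: Graphs are finite, have no loops, but may have multiple edges; degrees count multiplicities. For $S\subseteq V(G)$, $G\setminus S$ is the graph obtained by deleting $S$, $\omega(\cdot)$ is the number of connected components, and $I(G\setminus S)$ is the set of isolated vertices of $G\setminus S$. For a real function $t$ on $V(G)$, $G$ is $t$-iso-tough if $\sum_{v\in I(G\setminus S)}t(v)\le |S|$ for all $S\subseteq V(G)$. A near $f$-factor is a spanning subgraph $F$ with $d_F(v)=f(v)$ for all vertices $v$, except for at most one vertex $u$ with $d_F(u)=f(u)+1$. *)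

(* Defs.v *)
From HB Require Import structures.
From mathcomp Require Import all_boot all_order all_algebra.
Set Implicit Arguments. Unset Strict Implicit. Unset Printing Implicit Defensive.
Import Order.TTheory GRing.Theory Num.Theory.

(* A finite loopless multigraph on vertex type V is given by an edge
   multiplicity function m : V -> V -> nat (m u v = number of edges uv). *)
Definition multigraph (V : finType) (m : V -> V -> nat) : Prop :=
  (forall u v, m u v = m v u) /\ (forall v, m v v = 0%N).

Definition deg (V : finType) (m : V -> V -> nat) (v : V) : nat :=
  (\sum_(u : V) m v u)%N.

Definition adj_minus (V : finType) (m : V -> V -> nat) (S : {set V}) : rel V :=
  fun x y => [&& x \notin S, y \notin S & (0 < m x y)%N].

Definition omega (V : finType) (m : V -> V -> nat) (S : {set V}) : nat :=
  #|[set [set y in ~: S | connect (adj_minus m S) x y] | x in ~: S]|.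

Definition isolated (V : finType) (m : V -> V -> nat) (S : {set V}) : {set V} :=
  [set v in ~: S | [forall u in ~: S, m v u == 0%N]].

Definition iso_tough (R : realFieldType) (V : finType) (m : V -> V -> nat)
  (t : V -> R) : Prop :=
  forall S : {set V}, (\sum_(v in isolated m S) t v <= #|S|%:R)%R.

Definition spanning_subgraph (V : finType) (m mF : V -> V -> nat) : Prop :=
  multigraph mF /\ (forall u v, (mF u v <= m u v)%N).

Definition near_factor (V : finType) (m mF : V -> V -> nat) (f : V -> nat) : Prop :=
  spanning_subgraph m mF /\
  (forall v, deg mF v = f v \/ deg mF v = (f v).+1) /\
  (forall u w, deg mF u <> f u -> deg mF w <> f w -> u = w).

(* Main.v *)
Require Import Defs.
From HB Require Import structures.
From mathcomp Require Import all_boot all_order all_algebra.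
From mathcomp Require Import zify lra.
Import Order.TTheory GRing.Theory Num.Theory.
Set Implicit Arguments. Unset Strict Implicit. Unset Printing Implicit Defensive.

(** If the sum of f is odd, raise f by one at an arbitrary vertex; it suffices to
    find an exact factor for the resulting f'. By Tutte's f-factor theorem (with
    all components of G - S - T counted instead of the odd ones) failure gives
    disjoint S, T such that, with d the degree in G - S,
      omega(G - S - T) >= f'(S) + sum_T (d - f') + 2.
    The bound on omega(G - S - T) turns this into a |S| < sum_T w + 1 for
    w = 2 f - a - d. Choosing vertices of T with w > 0 greedily by decreasing w
    gives an independent I with sum_T w <= sum_I (d + 1) w, and isolating I by
    deleting S and the neighbours of I gives a |S| >= sum_I ((f + a/2)^2 - a d).
    Since (f + a/2)^2 - a d >= (d + 1) w + 1, this is a contradiction. *)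

(** * The Tutte-Berge formula *)

(** Points moved by [mu] split into pairs [{x, mu x}]; the induction deletes one such pair at a
    time. *)
Lemma odd_card_involution (T : finType) (mu : T -> T) (A : {set T}) :
  involutive mu -> {in A, forall x, mu x \in A} ->
  odd #|A| = odd #|[set x in A | mu x == x]|.
Proof.
move=> muK; have [n] := ubnP #|A|; elim: n A => // n IHn A leAn Amu.
have [[x /andP[Ax mux]]|fixA] := altP (@existsP _ (fun x => (x \in A) && (mu x != x))).
  have xNmu : x != mu x by rewrite eq_sym.
  have mxA : mu x \in A :\ x by rewrite !inE mux Amu.
  have cA : #|A| = #|A :\ x :\ mu x|.+2.
    by rewrite (cardsD1 x A) Ax (cardsD1 (mu x) (A :\ x)) mxA.
  have BA : {in A :\ x :\ mu x, forall y, mu y \in A :\ x :\ mu x}.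
    move=> y; rewrite !inE => /and3P[ymx yx Ay].
    rewrite Amu // andbT (inj_eq (can_inj muK)) yx /=.
    by apply: contra ymx => /eqP <-; rewrite muK.
  rewrite cA /= negbK IHn //; last by move: leAn; rewrite cA; lia.
  congr odd; apply: eq_card => y; rewrite !inE.
  have [->|_] := eqVneq y (mu x); first by rewrite muK (negPf xNmu) !andbF.
  by have [->|_] := eqVneq y x; rewrite ?(negPf mux) ?andbF ?(negPf mux) ?andbF.
congr odd; apply: eq_card => y; rewrite !inE.
move/existsPn: fixA => /(_ y); case: (y \in A) => //=; by rewrite negbK => ->.
Qed.

(** * Alternating orbits of two involutions *)

Section AlternatingOrbit.
Variables (T : finType) (mu nu : T -> T) (v : T).
Hypotheses (muK : involutive mu) (nuK : involutive nu) (nuv : nu v = v).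
Let pi x := nu (mu x).

Let pi_inj : injective pi.
Proof. exact: inj_comp (can_inj nuK) (can_inj muK). Qed.

Let pi_mu x : pi (mu x) = nu x. Proof. by rewrite /pi muK. Qed.

Let nu_pi x : nu (pi x) = mu x. Proof. by rewrite /pi nuK. Qed.

(** For matchings [mu] and [nu] with [v] missed by [nu], this is the vertex set of the alternating
    path starting at [v]. *)
Definition alt_orbit : {set T} := [set x | fconnect pi v x].

Lemma mem_alt_orbit : v \in alt_orbit. Proof. by rewrite inE. Qed.

Let alt_orbit_pi x : (pi x \in alt_orbit) = (x \in alt_orbit).
Proof. by rewrite !inE -(same_fconnect1_r pi_inj). Qed.

Let alt_orbitE x : x \in alt_orbit -> exists i, x = iter i pi v.
Proof. by rewrite inE => /iter_findex <-; exists (findex pi v x). Qed.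

(** Conjugation by [nu] inverts [pi], and [nu] fixes [v], so [nu] runs through the orbit backwards;
    by finiteness the backward orbit is the forward one. *)
Lemma alt_orbit_nu x : x \in alt_orbit -> nu x \in alt_orbit.
Proof.
case/alt_orbitE=> i ->; elim: i => [|i IHi]; first by rewrite nuv mem_alt_orbit.
by rewrite iterS nu_pi -alt_orbit_pi pi_mu.
Qed.

Lemma alt_orbit_mu x : x \in alt_orbit -> mu x \in alt_orbit.
Proof. by move=> Px; rewrite -alt_orbit_pi pi_mu alt_orbit_nu. Qed.

Let iter_nu_iter i : iter i pi (nu (iter i pi v)) = v.
Proof. by elim: i => [|i IHi] //=; rewrite nu_pi -iterS iterSr pi_mu. Qed.

(* A fixed point pi^i v of mu yields pi^(2i+1) v = v, so two of them give
   an odd period and the even period 2(j - i), hence the period j - i. *)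
Lemma alt_orbit_fixed_mu x y :
  x \in alt_orbit -> y \in alt_orbit -> mu x = x -> mu y = y -> x = y.
Proof.
case/alt_orbitE=> i -> /alt_orbitE[j ->].
have per k : mu (iter k pi v) = iter k pi v -> iter (k + k.+1) pi v = v.
  by move=> muk; rewrite -[RHS](iter_nu_iter k) -pi_mu muk -iterS -iterD.
wlog le_ij : i j / i <= j.
  by move=> Hw; case/orP: (leq_total i j) => h fi fj; [|symmetry]; apply: Hw.
move=> /per peri /per perj.
have iter_inj k : injective (iter k pi).
  by elim: k => [|k IHk] z t //= /pi_inj /IHk.
have per_mul p q : iter p pi v = v -> iter (q * p) pi v = v.
  by move=> pv; elim: q => // q IHq; rewrite mulSn iterD IHq.
set k := j - i.
have per2k : iter (2 * k) pi v = v.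
  apply: (iter_inj (i + i.+1)); rewrite -iterD peri.
  by rewrite -[RHS]perj; congr (iter _ pi v); rewrite /k; lia.
have perk : iter k pi v = v.
  (* The period (2i+1)k minus i times the period 2k leaves the period k. *)
  have := per_mul _ k peri.
  have -> : k * (i + i.+1) = k + i * (2 * k) by lia.
  by rewrite iterD (per_mul _ _ per2k).
by rewrite -(subnK le_ij) addnC iterD perk.
Qed.

End AlternatingOrbit.

(** * Maximum matchings, Gallai's lemma and barriers *)

Section Matching.
Variables (T : finType) (e : rel T).
Hypothesis esym : symmetric e.
Implicit Types (W X : {set T}) (mu nu : {ffun T -> T}) (c : T -> T).

(* A matching of the subgraph induced on W is encoded as an involution whose
   fixed points are the uncovered vertices. *)
Definition matching W mu : bool :=
  [forall x, (mu (mu x) == x) && ((mu x == x) || (x \in W) && e x (mu x))].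

Definition missed W mu : {set T} := [set x in W | mu x == x].

Definition max_matching W mu : bool :=
  matching W mu &&
  [forall nu, matching W nu ==> (#|missed W mu| <= #|missed W nu|)].

(** A colouring constant along edges stands in for the components: its classes are unions of
    components, and an odd class contains an odd component. *)
Definition odd_classes (A : {set T}) c : {set T} :=
  [set k | odd #|[set x in A | c x == k]|].

Definition separated (A : {set T}) c : Prop :=
  {in A &, forall x y, e x y -> c x = c y}.

Lemma matchingP W mu :
  reflect (involutive mu /\ forall x, mu x != x -> x \in W /\ e x (mu x))
          (matching W mu).
Proof.
apply: (iffP forallP) => [mW|[muK mW] x].
  split=> [x|x mux]; first by have /andP[/eqP] := mW x.
  by have := mW x; rewrite (negPf mux) /= => /and3P[].
rewrite muK eqxx /=; case: eqVneq => //= mux.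
by have [-> ->] := mW x mux.
Qed.

Lemma matching_closed W mu x : matching W mu -> x \in W -> mu x \in W.
Proof.
case/matchingP=> muK mW Wx; have [-> //|mux] := eqVneq (mu x) x.
by have [] := mW (mu x); rewrite // muK eq_sym.
Qed.

Lemma odd_missed W mu : matching W mu -> odd #|missed W mu| = odd #|W|.
Proof.
move=> mW; have [muK _] := matchingP _ _ mW.
by rewrite [RHS](odd_card_involution muK) // => x; apply: matching_closed.
Qed.

Lemma ex_max_matching W : exists mu, max_matching W mu.
Proof.
have m1 : matching W [ffun x => x].
  by apply/matchingP; split=> x; rewrite !ffunE // eqxx.
case: (arg_minnP (fun mu => #|missed W mu|) m1) => mu mW mmin.
by exists mu; rewrite /max_matching mW; apply/forallP=> nu; apply/implyP=> /mmin.
Qed.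

Lemma max_matching_le W mu nu :
  max_matching W mu -> matching W nu -> #|missed W mu| <= #|missed W nu|.
Proof. by case/andP=> _ /forallP/(_ nu)/implyP. Qed.

Lemma max_matching_matching W mu : max_matching W mu -> matching W mu.
Proof. by case/andP. Qed.

Lemma max_matching_eq W mu nu :
  max_matching W mu -> matching W nu -> #|missed W nu| <= #|missed W mu| ->
  max_matching W nu.
Proof.
move=> Mmu mnu le; rewrite /max_matching mnu; apply/forallP=> xi; apply/implyP=> mxi.
exact: leq_trans le (max_matching_le Mmu mxi).
Qed.

(** Otherwise adding the edge between [x] and [y] to [mu] gives a matching that misses fewer
    vertices. *)
Lemma max_matching_adj W mu x y :
  max_matching W mu -> e x y -> x \in missed W mu -> y \in missed W mu -> x = y.
Proof.
move=> Mmu exy; rewrite !inE => /andP[Wx /eqP mux] /andP[Wy /eqP muy].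
apply/eqP; apply: contraT => xNy.
have [muK mW] := matchingP _ _ (max_matching_matching Mmu).
pose nu := [ffun z => if z == x then y else if z == y then x else mu z].
have yNx : (y == x) = false by rewrite eq_sym (negPf xNy).
have muN z : z != x -> z != y -> (mu z != x) && (mu z != y).
  move=> zx zy; rewrite -{1}mux -{1}muy !(inj_eq (can_inj muK)) zx //.
have mnu : matching W nu.
  apply/matchingP; split=> z; rewrite !ffunE.
    have [->|zx] := eqVneq z x; first by rewrite yNx eqxx.
    have [->|zy] := eqVneq z y; first by rewrite eqxx.
    by have /andP[/negPf -> /negPf ->] := muN z zx zy; rewrite muK.
  have [->|zx] := eqVneq z x; first by [].
  have [->|zy] := eqVneq z y; first by rewrite esym.
  exact: mW.
have := max_matching_le Mmu mnu; rewrite leqNgt => /negP[].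
apply: proper_card; apply/properP; split; last first.
  by exists x; rewrite !inE ?Wx ?mux ?ffunE ?eqxx //= yNx.
apply/subsetP=> z; rewrite !inE ffunE => /andP[-> /=].
by have [->|_] := eqVneq z x; rewrite ?yNx //; have [->|//] := eqVneq z y; rewrite (negPf xNy).
Qed.

Definition swap (P : {set T}) mu nu : {ffun T -> T} :=
  [ffun x => if x \in P then nu x else mu x].

Lemma matching_swap W (P : {set T}) mu nu :
  matching W mu -> matching W nu -> {in P, forall x, mu x \in P} ->
  {in P, forall x, nu x \in P} -> matching W (swap P mu nu).
Proof.
move=> /matchingP[muK mW] /matchingP[nuK nW] Pmu Pnu.
apply/matchingP; split=> x; rewrite !ffunE; last by case: ifP => _; auto.
case Px: (x \in P); first by rewrite Pnu.
by case: ifP => [/Pmu|_]; rewrite muK // Px.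
Qed.

Lemma card_missed_swap W (P : {set T}) mu nu :
  #|missed W (swap P mu nu)| + #|missed W mu :&: P| =
  #|missed W mu| + #|missed W nu :&: P|.
Proof.
rewrite -(cardsID P (missed W mu)) -(cardsID P (missed W (swap P mu nu))).
have -> : missed W (swap P mu nu) :&: P = missed W nu :&: P.
  by apply/setP=> x; rewrite !inE ffunE; case: (x \in P); rewrite ?andbF.
have -> : missed W (swap P mu nu) :\: P = missed W mu :\: P.
  by apply/setP=> x; rewrite !inE ffunE; case: (x \in P).
lia.
Qed.

(* Gallai's lemma: avoidance of joint exposure is transitive through a vertex
   that some maximum matching misses. *)
Lemma gallai W mu nu u v w :
  max_matching W mu -> max_matching W nu ->
  u \in missed W mu -> w \in missed W mu -> v \in missed W nu -> u != w ->
  exists2 xi, max_matching W xi &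
    (v \in missed W xi) && ((u \in missed W xi) || (w \in missed W xi)).
Proof.
move=> Mmu Mnu muu muw nuv uNw.
have mmu := max_matching_matching Mmu; have mnu := max_matching_matching Mnu.
have [[muK _] [nuK _]] := (matchingP _ _ mmu, matchingP _ _ mnu).
have nuvE : nu v = v by move: nuv; rewrite inE => /andP[_ /eqP].
pose P := alt_orbit mu nu v.
have Pmu : {in P, forall x, mu x \in P} by move=> x; apply: alt_orbit_mu.
have Pnu : {in P, forall x, nu x \in P} by move=> x; apply: alt_orbit_nu.
have Pv : v \in P by apply: mem_alt_orbit.
have mxi := matching_swap mmu mnu Pmu Pnu.
(* The two opposite swaps on [P] together miss as many vertices as [mu] and [nu] together. Since
   [nu] is maximum, the swap applied to [nu] gains nothing, so the one applied to [mu] loses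
   nothing. *)
have Mxi : max_matching W (swap P mu nu).
  apply: (max_matching_eq Mmu mxi).
  have := max_matching_le Mnu (matching_swap mnu mmu Pnu Pmu).
  by have := card_missed_swap W P mu nu; have := card_missed_swap W P nu mu; lia.
exists (swap P mu nu) => //.
have mem_xi x : x \in missed W mu -> x \notin P -> x \in missed W (swap P mu nu).
  by move=> + /negPf NPx; rewrite !inE ffunE NPx.
apply/andP; split; first by move: nuv; rewrite !inE ffunE Pv.
(* Off [P] the swap agrees with [mu], so [u] or [w] stays missed unless both lie in [P]; then [mu]
   would have two fixed points on one alternating orbit. *)
have [Pu|/mem_xi->//] := boolP (u \in P).
have [Pw|/mem_xi->//] := boolP (w \in P); last by rewrite orbT.
case/negP: uNw; apply/eqP.
move: muu muw; rewrite !inE => /andP[_ /eqP muu] /andP[_ /eqP muw].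
exact: (alt_orbit_fixed_mu muK nuK nuvE).
Qed.

(** Once every vertex is missed by some maximum matching, this is an equivalence relation; its
    classes serve as the colours of an empty barrier. *)
Definition tied W : rel T := fun x y =>
  (x == y) ||
  [forall mu, max_matching W mu ==> ~~ ((x \in missed W mu) && (y \in missed W mu))].

Lemma tied_sym W : symmetric (tied W).
Proof.
by move=> x y; rewrite /tied eq_sym; congr (_ || _); apply: eq_forallb => mu; rewrite andbC.
Qed.

Lemma tiedN W x y : ~~ tied W x y ->
  x != y /\ exists2 mu, max_matching W mu & (x \in missed W mu) && (y \in missed W mu).
Proof.
rewrite negb_or => /andP[-> /forallPn[mu]].
by rewrite negb_imply negbK => /andP[Mmu mxy]; split=> //; exists mu.
Qed.

Lemma tiedP W mu x y : tied W x y -> max_matching W mu ->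
  x \in missed W mu -> y \in missed W mu -> x = y.
Proof.
case/orP=> [/eqP-> //|/forallP/(_ mu)/implyP H Mmu mx my].
by have := H Mmu; rewrite mx my.
Qed.

(** If a maximum matching missed [u] and [w], Gallai's lemma would give one missing [v] and one of
    them; the tie makes these two equal, and the other tie is then violated. *)
Lemma tied_trans W v u w :
  (exists2 nu, max_matching W nu & v \in missed W nu) ->
  tied W u v -> tied W v w -> tied W u w.
Proof.
case=> nu Mnu nuv uv vw; apply: contraT => /tiedN[uNw [mu Mmu /andP[muu muw]]].
have [xi Mxi /andP[xv /orP[xu|xw]]] := gallai Mmu Mnu muu muw nuv uNw.
  have E := tiedP uv Mxi xu xv; rewrite -E in vw.
  by case/negP: uNw; apply/eqP; apply: (tiedP vw Mmu).
have E := tiedP vw Mxi xv xw; rewrite E in uv.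
by case/negP: uNw; apply/eqP; apply: (tiedP uv Mmu).
Qed.

Lemma matching_sub W W' mu : W' \subset W -> matching W' mu -> matching W mu.
Proof.
move/subsetP=> sW /matchingP[muK mW]; apply/matchingP; split=> // x /mW[Wx exy].
by rewrite sW.
Qed.

(** A vertex covered by every maximum matching is put into the barrier and induction applies to the
    rest. Without such a vertex the empty barrier works, coloured by tie classes. *)
Lemma tutte_berge W : exists mu X c,
  [/\ matching W mu, X \subset W, separated (W :\: X) c &
      #|missed W mu| + #|X| <= #|odd_classes (W :\: X) c|].
Proof.
have [n] := ubnP #|W|; elim: n W => // n IHn W leWn.
have [mu Mmu] := ex_max_matching W.
have mmu := max_matching_matching Mmu.
have [muK mW] := matchingP _ _ mmu.
have [|] := altP (@existsP _ (fun v => (v \in W) &&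
    [forall nu, max_matching W nu ==> (v \notin missed W nu)])).
  case=> v /andP[Wv /forallP covv].
  have cW : #|W| = #|W :\ v|.+1 by rewrite (cardsD1 v W) Wv.
  have [|nu [X [c [mnu XW sepc leX]]]] := IHn (W :\ v); first by rewrite cW in leWn; lia.
  have mnuW : matching W nu by apply: matching_sub mnu; apply: subD1set.
  have vX : v \notin X by apply/negP=> /(subsetP XW); rewrite !inE eqxx.
  have WX : W :\: (v |: X) = W :\ v :\: X.
    by apply/setP=> x; rewrite !inE negb_or; case: (x == v); rewrite /= ?andbF.
  have nuv : nu v = v.
    have [_ H] := matchingP _ _ mnu; apply/eqP; apply: contraT => /H[].
    by rewrite !inE eqxx.
  have cm : #|missed W nu| = #|missed (W :\ v) nu|.+1.
    rewrite (cardsD1 v) inE Wv nuv eqxx /= add1n; congr (_.+1).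
    by apply: eq_card => x; rewrite !inE andbA.
  have lt : #|missed W mu| < #|missed W nu|.
    rewrite ltnNge; apply/negP=> le.
    have Mnu := max_matching_eq Mmu mnuW le.
    by have := covv nu; rewrite Mnu /= inE Wv nuv eqxx.
  exists mu, (v |: X), c; split=> //.
  - by rewrite subUset sub1set Wv (subset_trans XW) ?subD1set.
  - by rewrite WX.
  rewrite WX cardsU1 vX.
  (* Parity turns [lt] into a gap of two: one unit pays for [v] being missed by [nu] in [W], the
     other for [v] joining the barrier. *)
  have := odd_missed mnuW; rewrite -(odd_missed mmu); lia.
move/existsPn=> cov.
have expo v : v \in W -> exists2 nu, max_matching W nu & v \in missed W nu.
  move=> Wv; have := cov v; rewrite Wv /= => /forallPn[nu].
  by rewrite negb_imply negbK => /andP[]; exists nu.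
(* A canonical representative of the tie class; the default is never taken on [W], since [x] is tied
   to itself. *)
pose c x := odflt x [pick y in W | tied W x y].
have cP x : x \in W -> (c x \in W) && tied W x (c x).
  rewrite /c; case: pickP => [y|/(_ x)] //= N Wx.
  by move: N; rewrite Wx /tied eqxx.
have c_eq x y : x \in W -> y \in W -> tied W x y -> c x = c y.
  move=> Wx Wy xy.
  have E : (fun z => (z \in W) && tied W x z) =1 (fun z => (z \in W) && tied W y z).
    move=> z; case Wz: (z \in W) => //=; apply/idP/idP => h.
      by apply: tied_trans h; [apply: expo | rewrite tied_sym].
    by apply: tied_trans h; first exact: expo.
  have := cP x Wx; rewrite /c (eq_pick E); case: pickP => [//|N].
  by have := N y; rewrite Wy /tied eqxx.
have c_tied x y : x \in W -> y \in W -> c x = c y -> tied W x y.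
  move=> Wx Wy E; have /andP[Wc xc] := cP x Wx; have /andP[_ yc] := cP y Wy.
  by apply: tied_trans xc _; [apply: expo | rewrite E tied_sym].
have c_adj x y : x \in W -> y \in W -> e x y -> c x = c y.
  move=> Wx Wy exy; apply: c_eq => //; apply: contraT => /tiedN[xNy [nu Mnu /andP[mx my]]].
  by case/negP: xNy; apply/eqP; apply: max_matching_adj exy mx my.
exists mu, set0, c; split; rewrite ?sub0set // setD0; first exact: c_adj.
rewrite cards0 addn0 -(card_in_imset (f := c) (D := missed W mu)); last first.
  move=> x y mx my E; have [Wx Wy] : x \in W /\ y \in W.
    by move: mx my; rewrite !inE => /andP[-> _] /andP[-> _].
  exact: tiedP (c_tied _ _ Wx Wy E) Mmu mx my.
apply: subset_leq_card; apply/subsetP=> k /imsetP[x mx ->]; rewrite inE.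
have Wx : x \in W by move: mx; rewrite inE => /andP[].
(* The class of a missed [x] is closed under [mu], because adjacent vertices are tied, and [x] is
   its only fixed point; so it is odd. *)
rewrite (odd_card_involution muK); last first.
  move=> y; rewrite !inE => /andP[Wy /eqP <-]; rewrite (matching_closed mmu) //=.
  have [-> //|muy] := eqVneq (mu y) y; have [_ eyy] := mW y muy.
  by rewrite eq_sym (c_adj y (mu y)) // matching_closed.
suff -> : [set y in [set y in W | c y == c x] | mu y == y] = [set x] by rewrite cards1.
apply/setP=> y; rewrite !inE; apply/idP/eqP => [/andP[/andP[Wy /eqP cyx] muy]|->].
  by apply: tiedP (c_tied _ _ Wy Wx cyx) Mmu _ mx; rewrite inE Wy.
by rewrite Wx eqxx; move: mx; rewrite inE => /andP[].
Qed.

(* A vertex of X whose neighbours outside X carry at most two colours can be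
   moved out of X, merging these colours, at the cost of at most one odd class. *)
Lemma irreducible_barrier W X c d :
  X \subset W -> separated (W :\: X) c -> #|X| + d <= #|odd_classes (W :\: X) c| ->
  exists X' c',
    [/\ X' \subset W, separated (W :\: X') c',
        #|X'| + d <= #|odd_classes (W :\: X') c'| &
        {in X', forall x k1 k2,
           exists2 y, y \in W :\: X' & [&& e x y, c' y != k1 & c' y != k2]}].
Proof.
have [n] := ubnP #|X|; elim: n X c => // n IHn X c ltXn XW sepc leX.
have [/existsP[x /andP[Xx /existsP[k1 /existsP[k2 /forallP xk]]]]|irr] :=
    boolP [exists x in X, exists k1, exists k2, forall y in W :\: X,
             e x y ==> ((c y == k1) || (c y == k2))]; last first.
  exists X, c; split=> // x Xx k1 k2.
  move: irr; rewrite negb_exists_in => /forallP/(_ x)/implyP/(_ Xx).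
  move=> /existsPn/(_ k1)/existsPn/(_ k2); rewrite negb_forall_in.
  by case/existsP=> y /andP[Ay]; rewrite negb_imply negb_or => ?; exists y.
have {}xk y : y \in W :\: X -> e x y -> (c y == k1) || (c y == k2).
  by move=> Ay exy; move: (xk y); rewrite Ay exy.
have Wx := subsetP XW _ Xx.
have cX : #|X| = #|X :\ x|.+1 by rewrite (cardsD1 x X) Xx.
pose A := W :\: X.
have xA : x \notin A by rewrite !inE Xx.
have AE : W :\: (X :\ x) = x |: A.
  by apply/setP=> y; rewrite !inE; case: eqVneq => [->|].
(* Colour [k2] is merged into [k1], and [x] joins the merged class. *)
pose c' z := if z == x then k1 else if c z == k2 then k1 else c z.
have c'A y : y \in A -> c' y = if c y == k2 then k1 else c y.
  by rewrite /c'; case: eqVneq => // -> /(negP xA).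
have c'x : c' x = k1 by rewrite /c' eqxx.
have c'nbr y : y \in A -> e x y -> c' y = k1.
  move=> Ay exy; rewrite c'A //.
  by case/orP: (xk y Ay exy) => /eqP ->; rewrite ?eqxx ?if_same.
apply: (IHn (X :\ x) c'); first by rewrite cX in ltXn; lia.
- by apply: subset_trans XW; apply: subD1set.
- rewrite AE => y z /setU1P[->|Ay] /setU1P[->|Az] eyz //.
  + by rewrite c'x c'nbr.
  + by rewrite c'x c'nbr // esym.
  + by rewrite !c'A // (sepc _ _ Ay Az eyz).
rewrite AE; set O := odd_classes A c in leX *; set O' := odd_classes _ _.
suff : #|O| <= #|O'|.+1 by rewrite cX in leX; lia.
have keep k : k != k1 -> k != k2 -> k \in O -> k \in O'.
  move=> kk1 kk2; rewrite !inE; congr (odd _); apply: eq_card => y; rewrite !inE.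
  case: (eqVneq y x) => [->|yx].
    by rewrite Xx /= c'x eq_sym (negPf kk1).
  rewrite /c' (negPf yx) /=; case: (eqVneq (c y) k2) => // ->.
  by rewrite ![_ == k]eq_sym (negPf kk1) (negPf kk2).
have drop k : O :\ k \subset O' -> #|O| <= #|O'|.+1.
  move=> sub; rewrite (cardsD1 k O) -add1n leq_add ?leq_b1 //.
  exact: subset_leq_card.
(* Only the classes of [k1] and [k2] change. If these colours coincide or one class is not odd, at
   most one odd colour is lost. If both are odd, the merged class with [x] has size odd + odd + 1,
   so [k1] remains odd and only [k2] is lost. *)
have [k12|k12] := eqVneq k1 k2.
  apply: (drop k1); apply/subsetP=> k /setD1P[kk1 Ok].
  by apply: keep; rewrite -?k12.
have [Ok1|NOk1] := boolP (k1 \in O); last first.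
  apply: (drop k2); apply/subsetP=> k /setD1P[kk2 Ok].
  by apply: keep => //; apply: contraNneq NOk1 => <-.
have [Ok2|NOk2] := boolP (k2 \in O); last first.
  apply: (drop k1); apply/subsetP=> k /setD1P[kk1 Ok].
  by apply: keep => //; apply: contraNneq NOk2 => <-.
apply: (drop k2); apply/subsetP=> k /setD1P[kk2 Ok].
have [{k kk2 Ok}->|kk1] := eqVneq k k1; last exact: keep.
rewrite inE.
have -> : [set y in x |: A | c' y == k1] =
    x |: ([set y in A | c y == k1] :|: [set y in A | c y == k2]).
  apply/setP=> y; rewrite !inE; case: (eqVneq y x) => [->|yx]; first by rewrite c'x eqxx.
  rewrite /c' (negPf yx) /= -andb_orr; congr (_ && _).
  by case: (eqVneq (c y) k2) => _; rewrite ?eqxx ?orbT ?orbF.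
rewrite cardsU1 cardsU disjoint_setI0 ?cards0; last first.
  rewrite disjoint_subset; apply/subsetP=> y; rewrite !inE => /andP[_ /eqP ->].
  by rewrite (negPf k12) andbF.
have -> : x \notin [set y in A | c y == k1] :|: [set y in A | c y == k2].
  by rewrite in_setU !in_set Xx.
by move: Ok1 Ok2; rewrite !inE => o1 o2; rewrite subn0 /= !oddD o1 o2.
Qed.

End Matching.

(** * Factors with prescribed degrees *)

Lemma sum_ltn_ord N n : n <= N -> \sum_(i < N) (i < n) = n.
Proof.
move=> le; rewrite -[RHS]card_ord -sum1_card (big_ord_widen N (fun=> 1)) //.
by rewrite [RHS]big_mkcond /=; apply: eq_bigr => i _; case: ltnP.
Qed.

(** Such a [g] is constant on components, hence its image is an image of the set of components. *)
Lemma card_imset_le_omega (V I : finType) (m : V -> V -> nat) (A : {set V}) (g : V -> I) :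
  (forall u v, adj_minus m A u v -> g u = g v) -> #|g @: ~: A| <= omega m A.
Proof.
move=> g_adj.
have g_connect u v : connect (adj_minus m A) u v -> g u = g v.
  case/connectP=> p; elim: p u => [|w p IHp] u /=; first by move=> _ ->.
  by case/andP=> /g_adj -> /IHp h /h.
have [->|/set0Pn[v0 _]] := eqVneq (~: A) set0; first by rewrite imset0 cards0.
pose comp v := [set y in ~: A | connect (adj_minus m A) v y].
rewrite /omega -/comp.
apply: leq_trans (leq_imset_card (fun B : {set V} => g (odflt v0 [pick x in B])) _).
apply: subset_leq_card; apply/subsetP=> k /imsetP[v Av ->].
apply/imsetP; exists (comp v); first exact: imset_f.
case: pickP => [y|/(_ v)] /=; last by rewrite in_set Av connect0.
by rewrite in_set => /andP[_]; apply: g_connect.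
Qed.

(** * The gadget graph for f-factors *)

Section Gadget.
Variables (V : finType) (m : V -> V -> nat) (f : V -> nat) (N : nat).
Hypotheses (mG : multigraph m) (f_gt0 : forall v, 0 < f v).
Hypotheses (leN_f : forall v, f v <= N) (leN_m : forall u v, m u v <= N).

(* The gadget graph replaces v by f v twin copies [inl (v, i)] and subdivides the
   k-th edge uv by two ports [inr (u, v, k)] (adjacent to the copies of u) and
   [inr (v, u, k)]: perfect matchings of it correspond to f-factors, an edge being
   in the factor when its ports are matched to copies. *)
Local Notation gvertex := (V * 'I_N + V * V * 'I_N)%type.

(** The uniform bound [N] lets all copies and ports live in one finite type; this set selects those
    that exist. *)
Definition gadget_vertices : {set gvertex} :=
  [set x : gvertex | match x with inl p => p.2 < f p.1 | inr q => q.2 < m q.1.1 q.1.2 end].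

Definition gadget_rel : rel gvertex := fun x y =>
  match x, y with
  | inl p, inr q => p.1 == q.1.1
  | inr q, inl p => p.1 == q.1.1
  | inr q, inr q' => [&& q.1.1 == q'.1.2, q.1.2 == q'.1.1 & q.2 == q'.2]
  | inl _, inl _ => false
  end.

Definition is_copy (x : gvertex) := if x is inl _ then true else false.

(** Exchanging the two ports of each edge is an involution without fixed ports, so any set of ports
    closed under it is even. *)
Definition partner (x : gvertex) : gvertex :=
  if x is inr q then inr (q.1.2, q.1.1, q.2) else x.

Local Notation W := gadget_vertices.
Local Notation c_ v i := (inl (v, i) : gvertex).
Local Notation p_ u v k := (inr (u, v, k) : gvertex).

Lemma msym u v : m u v = m v u. Proof. by case: mG. Qed.
Lemma mloop v : m v v = 0. Proof. by case: mG. Qed.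

Lemma gadget_sym : symmetric gadget_rel.
Proof.
move=> [p|q] [p'|q'] //=; rewrite [q'.2 == _]eq_sym [q'.1.1 == _]eq_sym.
by rewrite [q'.1.2 == _]eq_sym andbCA.
Qed.

Lemma gadget_partner q q' : gadget_rel (inr q) (inr q') -> inr q' = partner (inr q).
Proof.
case: q q' => [[u v] k] [[u' v'] k'] /=.
by case/and3P=> /eqP -> /eqP -> /eqP ->.
Qed.

Lemma partnerK : involutive partner.
Proof. by move=> [p|[[u v] k]]. Qed.

Lemma partner_port u v k : p_ u v k \in W -> partner (p_ u v k) != p_ u v k.
Proof.
rewrite inE /=; case: (eqVneq u v) => [->|uv]; first by rewrite mloop.
by move=> _; apply: contra uv => /eqP[->].
Qed.

Lemma partner_closed x : x \in W -> partner x \in W.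
Proof. by case: x => [p|[[u v] k]] //; rewrite !inE /= msym. Qed.

Lemma card_gvertex (A : {set gvertex}) :
  #|A| = \sum_v \sum_(i < N) (c_ v i \in A) +
         \sum_u \sum_v \sum_(k < N) (p_ u v k \in A).
Proof.
rewrite -sum1_card big_mkcond big_sumType /=; congr (_ + _).
  rewrite pair_bigA; apply: eq_bigr => -[v i] _ /=; by case: (_ \in _).
rewrite pair_bigA pair_bigA; apply: eq_bigr => -[[u v] k] _ /=.
by case: (_ \in _).
Qed.

Lemma card_copies (A : {set V}) :
  \sum_v \sum_(i < N) (v \in A) && (i < f v) = \sum_(v in A) f v.
Proof.
rewrite [RHS]big_mkcond; apply: eq_bigr => v _.
by case: (v \in A); rewrite /= ?sum_ltn_ord // big1.
Qed.

Lemma odd_gadget : odd #|W| = odd (\sum_v f v).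
Proof.
rewrite (odd_card_involution partnerK partner_closed) card_gvertex.
rewrite [X in _ + X]big1 ?addn0; last first.
  move=> u _; rewrite big1 // => v _; rewrite big1 // => k _.
  by rewrite inE; have [/partner_port/negPf->|] := boolP (_ \in W).
congr odd; apply: eq_bigr => v _; rewrite -[RHS](sum_ltn_ord (leN_f v)).
by apply: eq_bigr => i _; rewrite !inE /= eqxx andbT.
Qed.

(** A port is matched either to a copy or to its partner, so the two ports of an edge are matched to
    copies together or not at all. This makes [B] symmetric. *)
Lemma gadget_factor mu :
  matching gadget_rel W mu -> missed W mu = set0 ->
  exists2 mF, spanning_subgraph m mF & forall v, deg mF v = f v.
Proof.
move=> /matchingP[muK mW] perf.
have muN x : x \in W -> mu x != x.
  by move=> Wx; have := in_set0 x; rewrite -perf inE Wx /= => /negbT.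
have muW x : x \in W -> mu x \in W.
  by move=> Wx; have [] := mW (mu x); rewrite // muK eq_sym muN.
have muE x : x \in W -> gadget_rel x (mu x) by move=> /muN/mW[].
pose B u v := [set k : 'I_N | (k < m u v) && is_copy (mu (p_ u v k))].
have B_sym u v : B u v = B v u.
  suff H u' v' : B u' v' \subset B v' u' by apply/eqP; rewrite eqEsubset !H.
  apply/subsetP=> k; rewrite !inE msym => /andP[km muc]; rewrite km.
  have Wp : p_ v' u' k \in W by rewrite inE.
  case E: (mu (p_ v' u' k)) => [//|q].
  have := muE _ Wp; rewrite E => /gadget_partner Eq.
  by move: muc; rewrite -[p_ u' v' k]/(partner (p_ v' u' k)) -Eq -E muK.
have B_le u v : #|B u v| <= m u v.
  rewrite -[leqRHS](sum_ltn_ord (leN_m u v)) -sum1_card big_mkcond /=.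
  by apply: leq_sum => k _; rewrite inE; case: (k < m u v) => //; case: is_copy.
exists (fun u v => #|B u v|) => [|v].
  split=> //; split=> [u v|v]; first by rewrite B_sym.
  by apply/eqP; rewrite -leqn0 -(mloop v) B_le.
pose A := [set x in W | if x is inl p then p.1 == v else false].
have cA : #|A| = f v.
  rewrite card_gvertex [X in _ + X]big1 ?addn0; last first.
    move=> u _; rewrite big1 // => w _; rewrite big1 // => k _.
    by rewrite !inE andbF.
  rewrite (bigD1 v) //= [X in _ + X]big1 ?addn0; last first.
    by move=> u uv; rewrite big1 // => i _; rewrite !inE /= (negPf uv) andbF.
  rewrite -[RHS](sum_ltn_ord (leN_f v)); apply: eq_bigr => i _.
  by rewrite !inE /= eqxx andbT.
(* The degree is read off the bijection [mu] from the copies of [v] onto the ports at [v] that are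
   matched to copies. *)
rewrite -cA -(card_imset _ (can_inj muK)) card_gvertex.
rewrite [X in _ = X + _]big1 ?add0n; last first.
  move=> u _; rewrite big1 // => i _.
  case: imsetP => // -[[p|q]]; rewrite !inE ?andbF // => /andP[Wp _] E.
  by have := muE (inl p); rewrite inE -E; move/(_ Wp).
rewrite (bigD1 v) //= [X in _ + X]big1 ?addn0; last first.
  move=> u uv; rewrite big1 // => w _; rewrite big1 // => k _.
  case: imsetP => // -[[p|q]]; rewrite !inE ?andbF // => /andP[Wp /eqP pv] E.
  have := muE (inl p); rewrite inE -E => /(_ Wp) /= /eqP.
  by rewrite pv => vu; rewrite vu eqxx in uv.
apply: eq_bigr => u _; rewrite -sum1_card big_mkcond; apply: eq_bigr => k _.
rewrite -[p_ v u k]muK (mem_imset _ _ (can_inj muK)) inE [_ \in A]inE.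
have [Wp|NWp] := boolP (p_ v u k \in W).
  rewrite muW //; have := muE _ Wp; move: Wp; rewrite inE /= => ->.
  by case: (mu _) => [p|q] //= ->.
have -> : mu (p_ v u k) \in W = false.
  by apply: contraNF NWp => /muW; rewrite muK.
by move: NWp; rewrite inE /= => /negPf ->.
Qed.

(** An irreducible barrier contains all or none of the copies of a vertex, and all or none of its
    ports. [S] collects the vertices with copies in it, [T] those with ports in it. *)
Lemma gadget_barrier :
  (forall v, 0 < deg m v) -> forall (X : {set gvertex}) c,
  X \subset W -> separated gadget_rel (W :\: X) c ->
  #|X| + 2 <= #|odd_classes (W :\: X) c| ->
  exists S T : {set V}, [disjoint S & T] /\
    \sum_(v in S) f v + \sum_(v in T) deg m v + 2 <=
    \sum_(v in T) f v + \sum_(v in T) \sum_(w in S) m v w + omega m (S :|: T).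
Proof.
move=> deg_gt0 X0 c0 X0W sep0 le0.
have [X [c [XW sepc leX irr]]] := irreducible_barrier gadget_sym X0W sep0 le0.
have irr1 x k1 k2 : x \in X ->
  exists y, [/\ y \in W, y \notin X, gadget_rel x y, c y != k1 & c y != k2].
  by move=> Xx; have [y /setDP[Wy Xy] /and3P[]] := irr x Xx k1 k2; exists y.
have sep x y : x \in W -> x \notin X -> y \in W -> y \notin X -> gadget_rel x y ->
    c x = c y.
  by move=> Wx Xx Wy Xy; apply: sepc; rewrite inE ?Xx ?Xy.
pose S := [set v | [exists i, c_ v i \in X]].
pose T := [set v | [exists u, [exists k, p_ v u k \in X]]].
(* Copies are twins: a copy of [v] left outside [X] would force one colour on all neighbours outside
   [X] of the copy in [X]. *)
have S_all v i : v \in S -> c_ v i \in W -> c_ v i \in X.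
  rewrite inE => /existsP[j Xj] Wi; apply: contraT => NXi.
  have [y [Wy Xy jy cy _]] := irr1 _ (c (c_ v i)) (c (c_ v i)) Xj.
  by case/negP: cy; rewrite eq_sym; apply/eqP/sep => //; case: y jy {Wy Xy}.
(* The partner of a port accounts for only one colour, so irreducibility yields two copies of [v]
   outside [X] with different colours; a port of [v] outside [X] would join them. *)
have T_copies v : v \in T -> exists i j,
    [/\ c_ v i \in W, c_ v i \notin X, c_ v j \in W & c_ v j \notin X] /\
    c (c_ v i) != c (c_ v j).
  rewrite inE => /existsP[u /existsP[k Xp]].
  have copy y : gadget_rel (p_ v u k) y -> c y != c (p_ u v k) -> exists i, y = c_ v i.
    case: y => [[w i]|q]; first by move=> /= /eqP ->; exists i.
    by move=> /gadget_partner ->; rewrite eqxx.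
  have [y [Wy Xy ey cy _]] := irr1 _ (c (p_ u v k)) (c (p_ u v k)) Xp.
  have [i yi] := copy y ey cy.
  have [z [Wz Xz ez cz czy]] := irr1 _ (c (p_ u v k)) (c y) Xp.
  have [j zj] := copy z ez cz.
  by exists j, i; rewrite -yi -zj.
have T_all v u k : v \in T -> p_ v u k \in W -> p_ v u k \in X.
  move=> /T_copies[i [j [[Wi Xi Wj Xj] cij]]] Wp; apply: contraT => NXp.
  case/negP: cij; apply/eqP; transitivity (c (p_ v u k)).
    by apply: sep => //=.
  by apply/esym/sep => //=.
have dST : [disjoint S & T].
  rewrite disjoint_subset; apply/subsetP=> v Sv; rewrite inE; apply/negP.
  by case/T_copies=> i [j [[/(S_all _ _ Sv) ->]]].
exists S, T; split=> //.
have X_port v u k : p_ v u k \in X -> v \in T.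
  by move=> Xp; rewrite inE; apply/existsP; exists u; apply/existsP; exists k.
have X_copy v i : c_ v i \in X -> v \in S.
  by move=> Xp; rewrite inE; apply/existsP; exists i.
have cX : \sum_(v in S) f v + \sum_(v in T) deg m v <= #|X|.
  rewrite card_gvertex leq_add //.
    rewrite -card_copies; apply: leq_sum => v _; apply: leq_sum => i _.
    have [/andP[Sv iv]|//] := boolP (_ && _).
    by rewrite S_all // inE.
  rewrite [X in X <= _]big_mkcond; apply: leq_sum => v _; case: ifP => // Tv.
  apply: leq_sum => u _; rewrite -[leqLHS](sum_ltn_ord (leN_m v u)).
  apply: leq_sum => k _; have [km|//] := ltnP k (m v u).
  by rewrite T_all // inE.
(* These vertices have all their gadget neighbours in [X], so each contributes at most one odd
   colour. *)
pose Y := [set x in W | match x with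
                        | inl p => p.1 \in T
                        | inr q => (q.1.1 \in S) && (q.1.2 \in T) end].
have cY : #|Y| = \sum_(v in T) f v + \sum_(v in T) \sum_(w in S) m v w.
  rewrite card_gvertex -card_copies; congr (_ + _).
    by apply: eq_bigr => v _; apply: eq_bigr => i _; rewrite !inE andbC.
  rewrite exchange_big [RHS]big_mkcond; apply: eq_bigr => v _.
  case Tv: (v \in T); last first.
    by rewrite big1 // => w _; rewrite big1 // => k _; rewrite in_set /= Tv !andbF.
  rewrite [RHS]big_mkcond; apply: eq_bigr => w _; rewrite msym.
  case Sw: (w \in S); last by rewrite big1 // => k _; rewrite in_set /= Sw andbF.
  rewrite -[RHS](sum_ltn_ord (leN_m w v)); apply: eq_bigr => k _.
  by rewrite in_set /= Sw Tv /= andbT in_set.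
pose U := ~: (S :|: T).
have UP v : v \in U -> v \notin S /\ v \notin T by rewrite !inE negb_or => /andP[].
have U_copy v i : v \in U -> c_ v i \notin X by move=> /UP[Sv _]; apply: contra Sv; apply: X_copy.
have U_port v u k : v \in U -> p_ v u k \notin X by move=> /UP[_ Tv]; apply: contra Tv; apply: X_port.
have N_gt0 (v : V) : 0 < N by apply: leq_trans (f_gt0 v) (leN_f v).
pose g v := c (c_ v (Ordinal (N_gt0 v))).
have W0 v : c_ v (Ordinal (N_gt0 v)) \in W by rewrite inE /= f_gt0.
have g_port v u k : v \in U -> p_ v u k \in W -> c (p_ v u k) = g v.
  by move=> Uv Wp; apply: sep; rewrite ?U_port ?U_copy ?W0 //=.
(* Positive degree supplies a port at [v], which is adjacent to all copies of [v]. *)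
have g_copy v i : v \in U -> c_ v i \in W -> c (c_ v i) = g v.
  move=> Uv Wi; have [u vu] : exists u, 0 < m v u.
    apply/existsP; apply: contraT => /existsPn v0; have := deg_gt0 v.
    by rewrite /deg big1 // => u _; apply/eqP; rewrite -leqn0 leqNgt v0.
  have Wp : p_ v u (Ordinal (N_gt0 v)) \in W by rewrite inE.
  by rewrite -(g_port v u _ Uv Wp); apply: sep; rewrite ?U_port ?U_copy //=.
have g_adj u v : adj_minus m (S :|: T) u v -> g u = g v.
  case/and3P=> NSu NSv uv.
  have [Uu Uv] : u \in U /\ v \in U by rewrite !in_setC.
  have Wp : p_ u v (Ordinal (N_gt0 v)) \in W by rewrite inE.
  have Wq : p_ v u (Ordinal (N_gt0 v)) \in W by rewrite inE /= msym.
  rewrite -(g_port _ _ _ Uu Wp) -(g_port _ _ _ Uv Wq).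
  by apply: sep; rewrite ?U_port //= !eqxx.
have cU : #|g @: U| <= omega m (S :|: T) by apply: card_imset_le_omega g_adj.
(* A class avoiding the colours of [Y] and of [g] on [U] consists of ports between vertices of [S].
   It is closed under [partner], hence even. *)
have cO : odd_classes (W :\: X) c \subset c @: Y :|: g @: U.
  apply/subsetP=> k; rewrite inE => odk; apply: contraTT odk.
  rewrite in_setU negb_or => /andP[kY kU].
  set A := [set x in W :\: X | c x == k].
  have noY x : x \in A -> x \notin Y.
    rewrite in_set => /andP[_ /eqP cx]; apply: contra kY => Yx.
    by apply/imsetP; exists x.
  have noU v : v \in U -> g v != k.
    by move=> Uv; apply: contra kU => /eqP <-; apply: imset_f.
  have portA u v l : p_ u v l \in A -> u \in S /\ v \in S.
    move=> Ap; have := noY _ Ap; move: (Ap); rewrite 2!in_set => /andP[/andP[NXp Wp] /eqP cp].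
    rewrite in_set Wp /= negb_and.
    have NTu : u \notin T by apply: contra NXp => Tu; apply: T_all.
    have Su : u \in S.
      apply: contraT => NSu; have Uu : u \in U by rewrite in_setC in_setU negb_or NSu.
      by have := noU _ Uu; rewrite -(g_port _ _ _ Uu Wp) cp eqxx.
    rewrite Su /= => NTv; split=> //; apply: contraT => NSv.
    have Uv : v \in U by rewrite in_setC in_setU negb_or NSv.
    have Wq : p_ v u l \in W by have := partner_closed Wp.
    have := noU _ Uv; rewrite -(g_port _ _ _ Uv Wq) -cp.
    suff -> : c (p_ u v l) = c (p_ v u l) by rewrite eqxx.
    by apply: sep => //=; [apply: U_port | rewrite !eqxx].
  have copyA v i : c_ v i \notin A.
    apply/negP=> Ap; have := noY _ Ap; move: (Ap); rewrite 2!in_set => /andP[/andP[NXp Wp] /eqP cp].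
    rewrite in_set Wp /= => NTv.
    have NSv : v \notin S by apply: contra NXp => Sv; apply: S_all.
    have Uv : v \in U by rewrite in_setC in_setU negb_or NSv.
    by have := noU _ Uv; rewrite -(g_copy _ i Uv) ?cp ?eqxx.
  rewrite (odd_card_involution partnerK); last first.
    move=> [[v i]|[[u v] l]] Ax; first by have := copyA v i; rewrite Ax.
    have [Su Sv] := portA _ _ _ Ax.
    move: Ax; rewrite 2!in_set => /andP[/andP[NXp Wp] /eqP cp].
    have Wq := partner_closed Wp.
    have NXq : partner (p_ u v l) \notin X.
      by apply/negP=> /X_port; rewrite (disjointFr dST Sv).
    rewrite 2!in_set Wq NXq -cp /=; apply/eqP/sep => //=.
    by rewrite !eqxx.
  rewrite (_ : [set _ in A | _] = set0) ?cards0 //; apply/setP=> x; rewrite in_set0 in_set.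
  case: x => [[v i]|[[u v] l]]; first by rewrite (negPf (copyA v i)).
  have [Ax|//] := boolP (_ \in A); apply/negbTE/partner_port.
  by move: Ax; rewrite 2!in_set => /andP[/andP[]].
apply: leq_trans (leq_add cX (leqnn 2)) _; apply: leq_trans leX _.
apply: leq_trans (subset_leq_card cO) _; rewrite -cY cardsU.
apply: leq_trans (leq_subr _ _) _; apply: leq_add => //; exact: leq_imset_card.
Qed.

End Gadget.

Lemma f_factor_of_components (V : finType) (m : V -> V -> nat) (f : V -> nat) :
  multigraph m -> (forall v, 0 < f v) -> (forall v, 0 < deg m v) ->
  ~~ odd (\sum_v f v) ->
  (forall S T : {set V}, [disjoint S & T] ->
     \sum_(v in T) f v + \sum_(v in T) \sum_(w in S) m v w + omega m (S :|: T) <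
     \sum_(v in S) f v + \sum_(v in T) deg m v + 2) ->
  exists2 mF, spanning_subgraph m mF & forall v, deg mF v = f v.
Proof.
move=> mG f_gt0 deg_gt0 evf cond.
pose N := \sum_v f v + \sum_u \sum_v m u v.
have leN_f v : f v <= N by rewrite /N (bigD1 v) //=; lia.
have leN_m u v : m u v <= N.
  apply: leq_trans (leq_addl _ _); rewrite (bigD1 u) //=.
  by apply: leq_trans (leq_addr _ _); rewrite (bigD1 v) //= leq_addr.
have [mu [X [c [mW XW sepc leX]]]] := tutte_berge (gadget_sym (N := N)) (gadget_vertices m f N).
have [perf|nperf] := eqVneq (missed (gadget_vertices m f N) mu) set0.
  exact: gadget_factor perf.
have := odd_missed mW; rewrite (odd_gadget mG leN_f) (negPf evf) => evm.
rewrite -card_gt0 in nperf.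
(* The number of missed vertices is even and positive, hence at least 2. *)
have {}leX : #|X| + 2 <= #|odd_classes (gadget_vertices m f N :\: X) c|.
  by apply: leq_trans leX; rewrite addnC leq_add2r; case: #|_| nperf evm => [|[|]].
have [S [T [dST]]] := gadget_barrier mG f_gt0 leN_f leN_m deg_gt0 XW sepc leX.
by rewrite leqNgt cond.
Qed.
(** * Isolated toughness *)

Lemma card_neighbors_le (V : finType) (m : V -> V -> nat) (A : {set V}) v :
  #|[set u in A | 0 < m v u]| <= \sum_(u in A) m v u.
Proof.
rewrite -sum1_card big_mkcond [leqRHS]big_mkcond; apply: leq_sum => u _.
by rewrite inE; case: (u \in A) => //=; case: (m v u).
Qed.

Lemma sum_setU_disjoint (R : nmodType) (V : finType) (S T : {set V}) (F : V -> R) :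
  [disjoint S & T] ->
  (\sum_(v in S :|: T) F v = \sum_(v in S) F v + \sum_(v in T) F v)%R.
Proof. by move=> dST; rewrite -bigU //; apply: eq_bigl => v; rewrite inE. Qed.

Section Toughness.
Local Open Scope ring_scope.
Variables (R : realFieldType) (V : finType) (m : V -> V -> nat).
Hypothesis mG : multigraph m.

(** Pick [x] in [B] of largest weight and discard its neighbours. Together with [x] they number at
    most 1 plus its degree outside [S], and none weighs more than [x]. *)
Lemma greedy_independent (w : V -> R) (S B : {set V}) :
  [disjoint B & S] -> {in B, forall v, 0 <= w v} ->
  exists I : {set V}, [/\ I \subset B, {in I &, forall x y, m x y = 0%N},
    \sum_(v in B) w v <= \sum_(v in I) (1 + (\sum_(u in ~: S) m v u)%:R) * w v &
    B != set0 -> I != set0].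
Proof.
have [n] := ubnP #|B|; elim: n B => // n IHn B ltBn dBS w_ge0.
have [->|/set0Pn[x0 Bx0]] := eqVneq B set0.
  exists set0; split; rewrite ?sub0set ?big_set0 ?eqxx //.
  by move=> x y; rewrite inE.
case: (arg_maxP w Bx0) => x Bx xmax.
have Sx : x \notin S by rewrite (disjointFr dBS Bx).
pose B' := [set y in B | (y != x) && (m x y == 0%N)].
have B'B : B' \subset B by apply/subsetP=> y; rewrite inE => /andP[].
have [||v /(subsetP B'B)|I [IB' indI leI _]] := IHn B'.
- rewrite -ltnS; apply: leq_trans ltBn; rewrite ltnS; apply: proper_card; apply/properP; split=> //.
  by exists x; rewrite // inE eqxx andbF.
- exact: disjointWl B'B dBS.
- exact: w_ge0.
have xI : x \notin I by apply/negP=> /(subsetP IB'); rewrite inE eqxx andbF.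
have mxI y : y \in I -> m x y = 0%N /\ m y x = 0%N.
  move/(subsetP IB'); rewrite inE => /and3P[_ _ /eqP xy].
  by split=> //; rewrite (proj1 mG).
exists (x |: I); split.
- by rewrite subUset sub1set (subset_trans IB' B'B) andbT.
- move=> y z /setU1P[->|Iy] /setU1P[->|Iz]; last exact: indI.
  + by rewrite (proj2 mG).
  + by case: (mxI z Iz).
  + by case: (mxI y Iy).
- rewrite big_setU1 //= -(setID B B') (setIidPr B'B) sum_setU_disjoint; last first.
    by rewrite disjoints_subset setCD subsetUr.
  rewrite addrC lerD //.
  apply: (@le_trans _ _ (\sum_(v in B :\: B') w x)).
    by apply: ler_sum => v /setDP[Bv _]; apply: xmax.
  rewrite sumr_const -[leLHS]mulr_natl ler_wpM2r ?w_ge0 // nat1r ler_nat.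
  apply: (@leq_trans #|x |: [set u in ~: S | (0 < m x u)%N]|).
    apply: subset_leq_card; apply/subsetP=> u /setDP[Bu]; rewrite !inE Bu /=.
    by rewrite negb_and negbK (disjointFr dBS Bu) lt0n.
  by rewrite cardsU1 (leq_add (leq_b1 _)) // card_neighbors_le.
- by move=> _; apply/set0Pn; exists x; rewrite setU11.
Qed.

(** [Z] is [S] together with all neighbours of [I] outside [S]; counting edges bounds the number of
    neighbours. *)
Lemma independent_isolated (S I : {set V}) :
  [disjoint I & S] -> {in I &, forall x y, m x y = 0%N} ->
  exists2 Z : {set V}, I \subset isolated m Z &
    (#|Z| <= #|S| + \sum_(v in I) \sum_(u in ~: S) m v u)%N.
Proof.
move=> dIS indI; pose N := \bigcup_(v in I) [set u in ~: S | (0 < m v u)%N].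
exists (S :|: N).
  apply/subsetP=> v Iv; rewrite !inE negb_or (disjointFr dIS Iv) /=.
  apply/andP; split.
    by apply/bigcupP=> -[u Iu]; rewrite !inE (indI _ _ Iu Iv) andbF.
  apply/forall_inP=> u; rewrite !inE negb_or => /andP[Su NNu].
  rewrite -leqn0 leqNgt; apply: contra NNu => vu.
  by apply/bigcupP; exists v; rewrite ?inE ?Su.
apply: leq_trans (leq_card_setU _ _) _; rewrite leq_add2l.
rewrite /N; apply: (big_ind2 (fun (A : {set V}) k => #|A| <= k)%N); rewrite ?cards0 //.
  by move=> A k B l leA leB; apply: leq_trans (leq_card_setU _ _) (leq_add leA leB).
by move=> v _; apply: card_neighbors_le.
Qed.

Variables (f : V -> nat) (a : R).
Hypotheses (f_gt0 : forall v, (0 < f v)%N) (a_ge1 : 1 <= a).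
Hypothesis le_af : forall v, a <= (f v)%:R.
Hypothesis tough : iso_tough m (fun v => ((f v)%:R + a / 2%:R) ^+ 2 / a).

Lemma tough_independent (S I : {set V}) :
  [disjoint I & S] -> {in I &, forall x y, m x y = 0%N} ->
  \sum_(v in I) (((f v)%:R + a / 2%:R) ^+ 2 - a * (\sum_(u in ~: S) m v u)%:R)
    <= a * #|S|%:R.
Proof.
move=> dIS indI; have [Z IZ leZ] := independent_isolated dIS indI.
have a_gt0 : 0 < a := lt_le_trans ltr01 a_ge1.
have t_ge0 v : 0 <= ((f v)%:R + a / 2%:R) ^+ 2 / a by rewrite divr_ge0 ?sqr_ge0 ?ltW.
have leI : \sum_(v in I) ((f v)%:R + a / 2%:R) ^+ 2 / a <= #|Z|%:R.
  apply: le_trans (tough Z); rewrite big_mkcond [leRHS]big_mkcond.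
  apply: ler_sum => v _; case: ifP => [/(subsetP IZ)->//|_]; case: ifP => // _.
rewrite sumrB lerBlDr -mulr_sumr -mulrDr -natr_sum -natrD.
rewrite -ler_pdivrMl // mulr_sumr.
apply: le_trans (_ : #|Z|%:R <= _); last by rewrite ler_nat.
by under eq_bigr do rewrite mulrC.
Qed.

Lemma tough_deg_ge v : ((f v)%:R + a / 2%:R) ^+ 2 <= a * (deg m v)%:R.
Proof.
have := @tough_independent set0 [set v].
rewrite big_set1 setC0 cards0 mulr0 subr_le0.
have -> : (\sum_(u in [set: V]) m v u = deg m v)%N.
  by apply: eq_bigl => u; rewrite inE.
apply; first by rewrite disjoint_sym disjoint_subset; apply/subsetP=> x; rewrite inE.
by move=> x y /set1P -> /set1P ->; rewrite (proj2 mG).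
Qed.

Lemma tough_deg_gt0 v : (0 < deg m v)%N.
Proof.
rewrite lt0n; apply: contraTneq (tough_deg_ge v) => ->.
by rewrite mulr0 -ltNge exprn_gt0 //; have := a_ge1; have := le_af v; lra.
Qed.

(* The summand 1 on the left pays for the vertex where f' = f + 1. *)
Lemma tough_deficiency (S T : {set V}) :
  [disjoint S & T] -> T != set0 ->
  \sum_(v in T) (2%:R * (f v)%:R - a - (\sum_(u in ~: S) m v u)%:R) + 1 <= a * #|S|%:R.
Proof.
move=> dST T0; set w := fun v => (2%:R * (f v)%:R - a - (\sum_(u in ~: S) m v u)%:R).
pose B := [set v in T | 0 < w v].
have BT : B \subset T by apply/subsetP=> v; rewrite inE => /andP[].
have dBS : [disjoint B & S] by apply: disjointWl BT _; rewrite disjoint_sym.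
have [|I [IB indI leI I0]] := greedy_independent (w := w) dBS.
  by move=> v; rewrite inE => /andP[_ /ltW].
have [B0|/I0/set0Pn[v Iv]] := eqVneq B set0; last first.
  apply: le_trans (tough_independent (disjointWl IB dBS) indI).
  have leT : \sum_(v in T) w v <= \sum_(v in B) w v.
    rewrite big_mkcond [leRHS]big_mkcond; apply: ler_sum => u _; rewrite inE.
    by case: (u \in T) => //=; case: ltP.
  apply: le_trans (lerD (le_trans leT leI) (lexx 1)) _.
  have a1 := a_ge1.
  (* With f, d for the values at [u], right minus left is (f - d - 1/2)^2 + (a-1)(f-1) + (a-1)^2/4 +
     5(a-1)/2. *)
  have pt u : (1 + (\sum_(x in ~: S) m u x)%:R) * w u + 1 <=
      ((f u)%:R + a / 2%:R) ^+ 2 - a * (\sum_(x in ~: S) m u x)%:R.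
    rewrite /w; set d := (\sum_(x in _) _)%:R.
    have f1 : 1 <= (f u)%:R :> R by rewrite ler1n.
    have := sqr_ge0 ((f u)%:R - d - 1 / 2%:R).
    have : 0 <= (a - 1) * ((f u)%:R - 1) by by apply: mulr_ge0; lra.
    have : 0 <= (a - 1) ^+ 2 by apply: sqr_ge0.
    nra.
  (* The extra 1 is spent at the single vertex [v] of [I], so [I] must be nonempty. *)
  rewrite (big_setD1 v) //= [leRHS](big_setD1 v) //= addrAC lerD //.
  by apply: ler_sum => u _; apply: le_trans (pt u); rewrite lerDl.
have w_le0 v : v \in T -> w v <= 0.
  by move=> Tv; have := in_set0 v; rewrite -B0 inE Tv /= => /negbT; rewrite -leNgt.
(* No weight is positive here. A nonempty [S] gives a|S| >= 1; for empty [S] one vertex of [T] must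
   have weight at most -1. *)
have [S0|S0] := eqVneq S set0; last first.
  apply: (@le_trans _ _ 1); first by rewrite gerDr sumr_le0.
  have : 1 <= #|S|%:R :> R by rewrite ler1n card_gt0.
  by have := a_ge1; nra.
have [v Tv] := set0Pn _ T0.
(* From the degree bound, a w <= f(a - f) - 5a^2/4 <= -5a^2/4, so w <= -5a/4 < -1. *)
have wv : w v + 1 <= 0.
  have := tough_deg_ge v; rewrite /w S0 setC0.
  have -> : (\sum_(u in [set: V]) m v u = deg m v)%N by apply: eq_bigl => u; rewrite inE.
  move: (deg m v)%:R (le_af v) a_ge1 => d leaf a1.
  have : 0 <= ((f v)%:R - a) ^+ 2 by apply: sqr_ge0.
  nra.
have -> : #|S| = 0%N by rewrite S0 cards0.
rewrite mulr0 (big_setD1 v) //= addrAC -[leRHS]addr0 lerD //.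
by apply: sumr_le0 => u /setD1P[_ /w_le0].
Qed.

End Toughness.

(** * Existence of the near factor *)

Theorem mainTheorem5 (R : realFieldType) (V : finType) (m : V -> V -> nat)
  (f : V -> nat) (a : R) :
  multigraph m ->
  (forall v, (0 < f v)%N) ->
  (1 <= a)%R ->
  (forall v, (a <= (f v)%:R)%R) ->
  iso_tough m (fun v => (((f v)%:R + a / 2%:R) ^+ 2 / a)%R) ->
  (forall S : {set V},
      ((omega m S)%:R < \sum_(v in S) ((f v)%:R - a) + 2%:R)%R) ->
  exists mF : V -> V -> nat, near_factor m mF f.
Proof.
move=> mG f_gt0 a_ge1 le_af tough comps.
have [dl dl1 evf] : exists2 dl : V -> bool,
    (forall u w, dl u -> dl w -> u = w) & ~~ odd (\sum_v (f v + dl v)).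
  case odf: (odd (\sum_v f v)); last first.
    by exists xpred0 => //; rewrite big_split /= [X in _ + X]big1 // addn0 odf.
  have [v0 _] : exists v0, v0 \in V.
    apply/existsP; apply: contraTT odf => /existsPn noV.
    by rewrite big1 // => v; have := noV v.
  exists (pred1 v0) => [u w /eqP-> /eqP->//|].
  by rewrite big_split oddD odf (bigD1 v0) //= eqxx big1 // => v /negPf ->.
have sum_dl (A : {set V}) : \sum_(v in A) dl v <= (A != set0).
  have [->|A0] := eqVneq A set0; first by rewrite big_set0.
  have [/existsP[u /andP[Au du]]|/existsPn nodl] := boolP [exists u in A, dl u].
    rewrite (big_setD1 u) //= du big1 // => w /setD1P[wu _].
    by apply/eqP; rewrite eqb0; apply: contra wu => dw; apply/eqP/dl1.
  by rewrite big1 // => u Au; have := nodl u; rewrite Au /= => /negPf ->.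
have fdl_gt0 v : 0 < f v + dl v by rewrite addn_gt0 f_gt0.
have deg_gt0 := tough_deg_gt0 mG a_ge1 le_af tough.
have [S T dST|mF sub degF] := f_factor_of_components mG fdl_gt0 deg_gt0 evf.
  rewrite ltnNge; apply/negP=> le.
  have degT : \sum_(v in T) deg m v = \sum_(v in T) \sum_(w in S) m v w +
      \sum_(v in T) \sum_(u in ~: S) m v u.
    rewrite -big_split; apply: eq_bigr => v _.
    rewrite /deg (bigID (mem S)) /=; congr (_ + _).
    by apply: eq_bigl => u; rewrite inE.
  rewrite !big_split /= degT in le.
  (* Raising f inside [S] only strengthens the left side, so that term is dropped; inside [T] it
     costs at most 1, and nothing when [T] is empty. *)
  have {}le : \sum_(v in S) f v + \sum_(v in T) \sum_(u in ~: S) m v u + 2 <=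
    \sum_(v in T) f v + (T != set0) + omega m (S :|: T) by have := sum_dl T; lia.
  have := comps (S :|: T); rewrite sum_setU_disjoint // !sumrB !sumr_const.
  rewrite -(ler_nat R) !natrD !natr_sum in le.
  (* For empty [T] the component bound alone contradicts [le]; otherwise the extra 1 is absorbed by
     the deficiency bound. *)
  have [T0|T0] := eqVneq T set0.
    rewrite T0 !big_set0 eqxx in le *; rewrite cards0 mulr0n -(mulr_natr a).
    have : (0 <= a * #|S|%:R)%R by rewrite mulr_ge0 // (le_trans ler01).
    by move: le => /=; lra.
  have := tough_deficiency mG f_gt0 a_ge1 le_af tough dST T0.
  rewrite !sumrB sumr_const -mulr_sumr -!(mulr_natr a); move: le; rewrite T0 /=. lra.
exists mF; split=> //; have dF v : deg mF v != f v -> dl v.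
  by rewrite degF; case: (dl v); rewrite // addn0 eqxx.
split=> [v|u w /eqP/dF du /eqP/dF dw]; last exact: dl1.
by rewrite degF; case: (dl v); rewrite ?addn1 ?addn0; [right|left].
Qed.
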